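(* If $G$ is a connected graph on an even number $n\geq 4$ of vertices with $q(G)=2$ and $|E(G)|=2n-4$, then $G$ is isomorphic to $Q_3$ or to the double-ended candle $G_{n/2}$.
   Context: For a graph $G$ on $n$ vertices, $\mathcal{S}(G)$ is the set of real symmetric $n\times n$ matrices $A=[a_{ij}]$ with $a_{ij}\neq0$ for $i\ne j$ iff $\{i,j\}\in E(G)$ (diagonal unrestricted); $q(G)$ is the minimum number of distinct eigenvalues of a matrix in $\mathcal{S}(G)$. $Q_3$ is the 3-dimensional cube graph. Double-ended candle: for $k\geq 2$, $G_k$ is the graph on $\{1,\dots,2k\}$ with levels $L_0=\{1\}$, $L_i=\{2i,2i+1\}$ ($1\le i\le k-1$), $L_k=\{2k\}$, two vertices adjacent iff they lie in consecutive levels. *)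

(* Defs.v *)
(* reals as an abstract realType (all are isomorphic to R). *)
From HB Require Import structures.
From mathcomp Require Import all_boot all_order all_algebra.
From mathcomp Require Import reals.
Set Implicit Arguments. Unset Strict Implicit. Unset Printing Implicit Defensive.
Import Order.TTheory GRing.Theory Num.Theory.
Local Open Scope ring_scope.

Definition simple_graph (n : nat) (e : rel 'I_n) : Prop :=
  (forall x y, e x y = e y x) /\ (forall x, e x x = false).

Definition connected_graph (n : nat) (e : rel 'I_n) : Prop :=
  forall x y, connect e x y.

Definition num_edges (n : nat) (e : rel 'I_n) : nat :=
  #|[set p : 'I_n * 'I_n | (p.1 < p.2)%N && e p.1 p.2]|.

Definition graph_iso (n m : nat) (e : rel 'I_n) (e' : rel 'I_m) : Prop :=
  exists f : 'I_n -> 'I_m, bijective f /\ forall x y, e' (f x) (f y) = e x y.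

Definition in_S (R : realType) (n : nat) (e : rel 'I_n) (A : 'M[R]_n) : Prop :=
  A^T = A /\ forall i j : 'I_n, i != j -> (A i j != 0) = e i j.

Definition num_distinct_eig (R : realType) (n : nat) (A : 'M[R]_n) (k : nat) : Prop :=
  exists s : seq R, [/\ uniq s, size s = k & forall a, eigenvalue A a = (a \in s)].

Definition q_eq (R : realType) (n : nat) (e : rel 'I_n) (k : nat) : Prop :=
  (exists A : 'M[R]_n, in_S e A /\ num_distinct_eig A k) /\
  (forall (A : 'M[R]_n) (m : nat), in_S e A -> num_distinct_eig A m -> (k <= m)%N).

Definition bit (i x : nat) : bool := odd (x %/ 2 ^ i).
Definition Q3 : rel 'I_8 := fun x y =>
  ((bit 0 x != bit 0 y) + (bit 1 x != bit 1 y) + (bit 2 x != bit 2 y) == 1)%N.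

(* Double-ended candle: vertex v : 'I_n is vertex v+1 of the paper, whose level is
   (v+1)./2 (levels L_0={1}, L_i={2i,2i+1}, L_k={2k}); adjacent iff levels consecutive.
   For n = 2k this is G_k. *)
Definition candle_level (v : nat) : nat := (v.+1)./2.
Definition candle (n : nat) : rel 'I_n := fun x y =>
  ((candle_level x).+1 == candle_level y) || ((candle_level y).+1 == candle_level x).

(* Main.v *)
(** A matrix A in S(G) with two eigenvalues a, b satisfies (A - a)(A - b) = 0, so
    columns of nonadjacent vertices are orthogonal; in particular nonadjacent
    vertices never have exactly one common neighbor. Hence every vertex at
    distance at least 2 from a root v has at least two neighbors one step closer
    to v, and counting edges by their farther endpoint shows that only
    deg v - 2 of the 2n - 4 edges are not forced. If deg v = 2, the distance
    levels are independent, every vertex beyond level 1 has exactly two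
    predecessors, and orthogonality forces every level to have at most two
    vertices: G is a candle. Otherwise the minimum degree is 3; rooting at a
    vertex of degree 3 leaves a single unforced edge, which the degree condition
    places in the last level. Two vertices of level 2 with different predecessors
    then force the last level to be a single vertex at distance 3: G is the cube. *)
Require Import Defs.
From mathcomp Require Import all_boot all_order all_algebra.
From mathcomp Require Import reals complex ring lra zify.
Set Implicit Arguments. Unset Strict Implicit. Unset Printing Implicit Defensive.

(** * Spectral theory: a quadratic annihilating a symmetric matrix *)

Section LinearAlgebra.
Import Order.TTheory GRing.Theory Num.Theory.
Local Open Scope ring_scope.

(** Over [R[i]] the matrix is Hermitian, hence unitarily diagonalizable with real spectrum. Each
    diagonal entry is [a] or [b], so the product of the two diagonal factors vanishes. *)
Lemma symmetric_two_eigenvalues (R : rcfType) (n : nat) (A : 'M[R]_n) (a b : R) :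
  A^T = A -> (forall c, eigenvalue A c -> c = a \/ c = b) ->
  (A - a%:M) *m (A - b%:M) = 0.
Proof.
move=> symA eigA; pose f : {rmorphism R -> R[i]} := real_complex R.
have hermA : map_mx f A \is hermsymmx.
  apply: realsym_hermsym.
    apply/is_hermitianmxP; rewrite expr0 scale1r.
    by apply/matrixP=> i j; rewrite !mxE -[in LHS]symA mxE.
  by apply/mxOverP => i j; rewrite mxE; apply/complex_realP; exists (A i j).
have /orthomx_spectralP eqA := hermitian_normalmx hermA.
have realD := hermitian_spectral_diag_real hermA.
have uP := spectral_unit (map_mx f A).
move: eqA realD uP; set P := spectralmx _; set D := spectral_diag _.
move=> eqA realD uP.
have PA : P *m map_mx f A = diag_mx D *m P by rewrite eqA !mulmxA mulmxV // mul1mx.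
(* Row [j] of [P] is a left eigenvector for [D 0 j], nonzero because [P] is invertible. *)
have eigD j : D 0 j = f a \/ D 0 j = f b.
  have /mxOverP/(_ 0 j)/complex_realP [k Dk] := realD.
  have : eigenvalue (map_mx f A) (f k).
    apply/eigenvalueP; exists (row j P).
      by rewrite -row_mul PA mul_diag_mx; apply/rowP=> i; rewrite !mxE Dk.
    rewrite rowE; apply/eqP=> /(congr1 (mulmx^~ (invmx P))).
    rewrite mulmxK // mul0mx => /matrixP/(_ 0 j)/eqP.
    by rewrite !mxE !eqxx oner_eq0.
  by rewrite eigenvalue_map => /eigA [] <-; rewrite Dk; [left|right].
have fact0 : (diag_mx D - (f a)%:M) *m (diag_mx D - (f b)%:M) = 0.
  rewrite -!diag_const_mx -!linearB /= mulmx_diag -(linear0 (@diag_mx _ n)); congr diag_mx.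
  apply/rowP=> j; rewrite !mxE.
  by case: (eigD j) => ->; rewrite subrr ?mul0r ?mulr0.
have sub c : map_mx f A - (f c)%:M = invmx P *m (diag_mx D - (f c)%:M) *m P.
  rewrite mulmxBr mulmxBl -eqA; congr (_ - _).
  by rewrite mul_mx_scalar -scalemxAl mulVmx // scalemx1.
apply: (@map_mx_inj _ _ f); rewrite map_mx0 map_mxM !map_mxB !map_scalar_mx !sub.
by rewrite !mulmxA mulmxK // -[invmx P *m _ *m _]mulmxA fact0 mulmx0 mul0mx.
Qed.
End LinearAlgebra.

(** * Orthogonality relations for a matrix with two eigenvalues *)

Section Orthogonality.
Import Order.TTheory GRing.Theory Num.Theory.
Local Open Scope ring_scope.
Variables (R : realType) (n : nat) (e : rel 'I_n) (A : 'M[R]_n).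
Hypotheses (simp : simple_graph e) (SA : in_S e A) (qA : num_distinct_eig A 2).

Lemma in_S_edge_neq0 (i j : 'I_n) : e i j -> A i j != 0.
Proof.
by move=> ij; rewrite (proj2 SA) //; apply: contraTneq ij => ->; rewrite (proj2 simp).
Qed.

Lemma in_S_nonedge_eq0 (i j : 'I_n) : i != j -> ~~ e i j -> A i j = 0.
Proof.
by move=> ij nij; apply/eqP; move: (proj2 SA i j ij); rewrite (negPf nij); case: eqP.
Qed.

(** Off the diagonal and off the edges, only the [A *m A] term of the quadratic survives. Its
    summands vanish unless [k] is a common neighbor; those at [k = i] and [k = j] vanish because
    [A i j = 0]. *)
Lemma nonadjacent_rows_orthogonal (i j : 'I_n) :
  i != j -> ~~ e i j -> \sum_(k | e i k && e k j) A i k * A k j = 0.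
Proof.
move=> ij nij; have [s [us ss eigs]] := qA.
have [a [b sE]] : exists a b, s = [:: a; b].
  by case: s ss {us eigs} => [|a [|b []]] // _; exists a, b.
have Aij := in_S_nonedge_eq0 ij nij.
have /matrixP/(_ i j) : (A - a%:M) *m (A - b%:M) = 0.
  apply: symmetric_two_eigenvalues => [|c]; first exact: (proj1 SA).
  by rewrite eigs sE !inE => /orP[] /eqP; [left|right].
rewrite mulmxBr mulmxBl mul_mx_scalar mul_scalar_mx scalerBr.
rewrite !mxE Aij (negPf ij) !mulr0 => sum0; rewrite ?subr0 in sum0.
rewrite -[RHS]sum0 big_mkcond; apply: eq_bigr => k _; case: ifP => // /negbT.
rewrite negb_and => /orP[ik|kj].
  have [<-|nik] := eqVneq i k; first by rewrite Aij mulr0.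
  by rewrite (in_S_nonedge_eq0 nik ik) mul0r.
have [->|nkj] := eqVneq k j; first by rewrite Aij mul0r.
by rewrite (in_S_nonedge_eq0 nkj kj) mulr0.
Qed.

(** Otherwise the orthogonality sum would be a single product of two nonzero entries. *)
Lemma not_unique_common_neighbor (i j k : 'I_n) :
  i != j -> ~~ e i j -> e i k -> e k j -> exists2 l, l != k & e i l && e l j.
Proof.
move=> ij nij ik kj.
have [/existsP[l /andP[lk ?]]|/existsPn none] :=
  boolP [exists l, (l != k) && (e i l && e l j)]; first by exists l.
have := nonadjacent_rows_orthogonal ij nij.
rewrite (bigD1 k) ?ik //= big_pred0 => [/eqP|l].
  by rewrite addr0 mulf_eq0 (negPf (in_S_edge_neq0 ik)) (negPf (in_S_edge_neq0 kj)).
by rewrite andbC; apply/negbTE/none.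
Qed.

(* The restrictions of columns j and l to {a, b} are both orthogonal to that of
   column i, hence parallel to each other, so j and l need another common neighbor. *)
Lemma parallel_common_neighbor (i j l a b : 'I_n) :
    a != b -> i != j -> i != l -> j != l -> ~~ e i j -> ~~ e i l -> ~~ e j l ->
    (forall k, (e i k && e k j) = (k \in [:: a; b])) ->
    (forall k, (e i k && e k l) = (k \in [:: a; b])) ->
  exists2 k, k \notin [:: a; b] & e j k && e k l.
Proof.
move=> ab ij il jl nij nil njl cij cil.
have [/existsP[k /andP[kab ?]]|/existsPn none] :=
  boolP [exists k, (k \notin [:: a; b]) && (e j k && e k l)]; first by exists k.
have cjl k : (e j k && e k l) = (k \in [:: a; b]).
  apply/idP/idP=> [jkl|kab].
    by move: (none k); rewrite jkl andbT negbK.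
  move: (cij k) (cil k); rewrite kab => /andP[_ kj] /andP[_ ->].
  by rewrite andbT (proj1 simp).
have sum2 (F : 'I_n -> R) : \sum_(k in [:: a; b]) F k = F a + F b.
  by rewrite -big_uniq /= ?big_cons ?big_nil ?addr0 // inE ab.
have := nonadjacent_rows_orthogonal ij nij; rewrite (eq_bigl _ _ cij) sum2.
have := nonadjacent_rows_orthogonal il nil; rewrite (eq_bigl _ _ cil) sum2.
have := nonadjacent_rows_orthogonal jl njl; rewrite (eq_bigl _ _ cjl) sum2.
have tr x y : A x y = A y x by rewrite -[in LHS](proj1 SA) mxE.
rewrite (tr j a) (tr j b).
have /andP[/in_S_edge_neq0 ia /in_S_edge_neq0 aj] : e i a && e a j by rewrite cij !inE eqxx.
have /andP[_ /in_S_edge_neq0 al] : e i a && e a l by rewrite cil !inE eqxx.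
move=> jl0 il0 ij0; exfalso.
(* This combination of the three orthogonality relations eliminates [A b j] and [A b l], leaving a
   product of nonzero factors. *)
have : (A i a ^+ 2 + A i b ^+ 2) * (A a j * A a l) = 0.
  have -> : (A i a ^+ 2 + A i b ^+ 2) * (A a j * A a l) =
     (A i a * A a j) * (A i a * A a l + A i b * A b l)
     - A i b * A b l * (A i a * A a j + A i b * A b j)
     + A i b ^+ 2 * (A a j * A a l + A b j * A b l) by ring.
  by rewrite il0 ij0 jl0 !mulr0 subrr addr0.
apply/eqP; rewrite !mulf_neq0 // gt_eqF //.
by apply: ltr_wpDr; rewrite ?sqr_ge0 // lt_neqAle eq_sym sqrf_eq0 ia sqr_ge0.
Qed.
End Orthogonality.

(** * Degrees and the combinatorial properties extracted from the matrix *)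

Section Degrees.
Variables (n : nat) (e : rel 'I_n).
Hypothesis simp : simple_graph e.

Definition degree (x : 'I_n) : nat := #|[set y | e x y]|.

(** The matrix enters the graph-theoretic arguments below only through this property and the
    next. *)
Definition unique_common_neighbor_free : Prop := forall i j k : 'I_n,
  i != j -> ~~ e i j -> e i k -> e k j -> exists2 l, l != k & e i l && e l j.

Definition common_neighbor_extension : Prop := forall i j l a b : 'I_n,
  a != b -> i != j -> i != l -> j != l -> ~~ e i j -> ~~ e i l -> ~~ e j l ->
  (forall k, (e i k && e k j) = (k \in [:: a; b])) ->
  (forall k, (e i k && e k l) = (k \in [:: a; b])) ->
  exists2 k, k \notin [:: a; b] & e j k && e k l.

Lemma card_rel_sum (q : rel 'I_n) :
  #|[set p : 'I_n * 'I_n | q p.1 p.2]| = \sum_x \sum_y q x y.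
Proof.
rewrite pair_bigA -sum1_card big_mkcond /=.
by apply: eq_bigr => p _; rewrite inE; case: (q _ _).
Qed.

(* Every edge is counted once by each tournament on the vertices. *)
Lemma double_tournament_edges (q : rel 'I_n) :
    (forall x y, x != y -> q x y = ~~ q y x) ->
  (\sum_x \sum_y (q x y && e x y)).*2 = \sum_x degree x.
Proof.
move=> qT; rewrite -addnn [X in _ + X]exchange_big -big_split /=.
apply: eq_bigr => x _; rewrite -big_split /degree -sum1_card [RHS]big_mkcond /=.
apply: eq_bigr => y _; rewrite inE (proj1 simp y x).
case exy: (e x y); rewrite ?andbF // !andbT.
rewrite (qT x y); first by case: (q y x).
by apply: contraTneq exy => ->; rewrite (proj2 simp).
Qed.

Lemma handshake : \sum_x degree x = (num_edges e).*2.
Proof.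
rewrite /num_edges (card_rel_sum (fun x y => (x < y) && e x y)).
rewrite (double_tournament_edges (q := fun x y => x < y)) // => x y.
rewrite -val_eqE /=; lia.
Qed.

(** If a neighbor [u] of [x] has another neighbor [w], then [x] gains a second neighbor: [w] itself,
    or a second common neighbor of [x] and [w]. Otherwise, if [x] had degree 1, [x] and [u] would
    form a whole component. *)
Lemma degree_ge2 : unique_common_neighbor_free -> connected_graph e -> 2 < n ->
  forall x, 2 <= degree x.
Proof.
move=> F1 conn n3 x; have [sym irr] := simp.
have nbr z : exists y, e z y.
  have /card_gt0P[y] : 0 < #|[set~ z]| by rewrite cardsC1 card_ord; lia.
  rewrite !inE; have /connectP[[|w p] /= pth ->] := conn z y; first by rewrite eqxx.
  by exists w; case/andP: pth.
have [u xu] := nbr x.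
have [/existsP[w /andP[uw wx]]|] := boolP [exists w, e u w && (w != x)].
  have [xw|nxw] := boolP (e x w).
    have nuw : u != w by apply: contraTneq uw => ->; rewrite irr.
    by apply/card_gt1P; exists u, w; rewrite !inE.
  have [|l lu /andP[xl _]] := F1 x w u _ nxw xu uw; first by rewrite eq_sym.
  by apply/card_gt1P; exists l, u; rewrite !inE.
move=> /existsPn onlyx; rewrite leqNgt; apply/negP=> d1.
have onlyu w : e x w -> w = u.
  move=> xw; apply/eqP; apply: contraLR d1 => wu; rewrite -leqNgt.
  by apply/card_gt1P; exists w, u; rewrite !inE.
have closed_xu y : connect e x y -> y \in [:: x; u].
  move=> /connectP[p pth ->] {y}.
  elim/last_ind: p pth => [|p w IH]; first by rewrite /= inE eqxx.
  rewrite rcons_path last_rcons => /andP[/IH]; rewrite !inE => /orP[] /eqP ->.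
    by move=> /onlyu ->; rewrite eqxx orbT.
  by move=> uw; move: (onlyx w); rewrite uw /= negbK => ->.
have : #|'I_n| <= size [:: x; u].
  apply: leq_trans (card_size _); apply/subset_leq_card/subsetP => y _.
  exact/closed_xu/conn.
by rewrite card_ord /=; lia.
Qed.
End Degrees.

(** * Distance from a root *)

Definition is_distance (n : nat) (e : rel 'I_n) (v : 'I_n) (d : 'I_n -> nat) : Prop :=
  [/\ forall x, (d x == 0) = (x == v),
      forall x y, e x y -> d y <= (d x).+1
    & forall x k, d x = k.+1 -> exists2 y, e y x & d y = k].

(** The witness is the least length of a walk from [v]. The clauses of [is_distance] determine it:
    the second bounds [d] by the length of any walk, the third builds a walk of length [d x]. *)
Lemma connected_distance (n : nat) (e : rel 'I_n) (v : 'I_n) :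
  connected_graph e -> exists d, is_distance e v d.
Proof.
move=> conn.
pose walk := fix walk k x := if k is k'.+1 then [exists y, walk k' y && e y x] else x == v.
have walkS k x y : walk k y -> e y x -> walk k.+1 x.
  by move=> wk yx; apply/existsP; exists y; apply/andP.
have ex_walk x : exists k, walk k x.
  have /connectP[p pth ->] := conn v x.
  elim/last_ind: p pth => [|p w IH]; first by exists 0; rewrite /= eqxx.
  rewrite rcons_path last_rcons => /andP[/IH [k wk] /(walkS _ _ _ wk)].
  by exists k.+1.
pose d x := ex_minn (ex_walk x).
have wd x : walk (d x) x by rewrite /d; case: ex_minnP.
have dmin x k : walk k x -> d x <= k by rewrite /d; case: ex_minnP => m _ H /H.
have dS x y : e x y -> d y <= (d x).+1.
  by move/(walkS _ _ _ (wd x)); apply: dmin.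
exists d; split=> // [x|x k dx].
  apply/eqP/idP=> [dx|/eqP->]; first by have := wd x; rewrite dx.
  by apply/eqP; rewrite -leqn0; apply: dmin => /=.
have := wd x; rewrite dx => /existsP[y /andP[wy yx]]; exists y => //.
by have := dS _ _ yx; have := dmin _ _ wy; lia.
Qed.

(** * Distance levels and the edge count *)

Section Levels.
Variables (n : nat) (e : rel 'I_n).
Hypotheses (simp : simple_graph e) (F1 : unique_common_neighbor_free e).
Variables (v : 'I_n) (d : 'I_n -> nat).
Hypothesis dist : is_distance e v d.

Definition level (i : nat) : {set 'I_n} := [set x | d x == i].
Definition preds (x : 'I_n) : {set 'I_n} := [set y | e y x & d y < d x].
(** The tie-break [y < x] charges an edge inside a level to only one of its ends. *)
Definition laterals (x : 'I_n) : {set 'I_n} := [set y | e y x & (d y == d x) && (y < x)].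
(** Edges charged to [x] beyond the forced number: 0 at the root, 1 at distance 1, 2 farther out. By
    [minn_le_preds] the subtraction never truncates. *)
Definition excess (x : 'I_n) : nat := #|preds x| + #|laterals x| - minn (d x) 2.

Lemma edge_distance x y : e x y -> d y <= (d x).+1 /\ d x <= (d y).+1.
Proof. by case: dist => _ dS _ xy; split; apply: dS; rewrite // (proj1 simp). Qed.

Lemma predsE x y : d x = (d y).+1 -> (y \in preds x) = e y x.
Proof. by rewrite !inE => ->; rewrite leqnn andbT. Qed.

Lemma in_preds x y : y \in preds x -> e y x /\ d x = (d y).+1.
Proof. by rewrite !inE => /andP[yx]; case: (edge_distance yx); lia. Qed.

Lemma level0 : level 0 = [set v].
Proof. by apply/setP=> x; rewrite !inE; case: dist. Qed.

Lemma dv : d v = 0.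
Proof. by case: dist => d0 _ _; apply/eqP; rewrite d0. Qed.

Lemma level1 : level 1 = [set x | e v x].
Proof.
have [d0 dS dP] := dist; apply/setP=> x; rewrite !inE; apply/eqP/idP=> [/dP[y yx /eqP]|vx].
  by rewrite d0 => /eqP <-.
have := dS _ _ vx; rewrite dv; case: (d x) (d0 x) => [/esym/eqP xv|[|]] //.
by rewrite xv (proj2 simp) in vx.
Qed.

Lemma distance_ge2_nonadjacent x y : (d x).+1 < d y -> (x != y) /\ ~~ e x y.
Proof.
move=> dxy; split; first by apply: contraTneq dxy => ->; lia.
by apply/negP=> /edge_distance[]; lia.
Qed.

(** A vertex two steps back from [x] is not adjacent to [x] but shares a neighbor with it, hence
    shares a second one, and both lie in the level between. *)
Lemma minn_le_preds x : minn (d x) 2 <= #|preds x|.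
Proof.
have [_ _ dP] := dist; case dx: (d x) => [|k]; first by rewrite min0n.
have [y yx dy] := dP _ _ dx.
have yP : y \in preds x by rewrite predsE ?dx ?dy.
case: k dx dy => [|k] dx dy; first by apply/card_gt0P; exists y.
have [z zy dz] := dP _ _ dy.
have [zx nzx] : z != x /\ ~~ e z x by apply: distance_ge2_nonadjacent; lia.
have [l ly /andP[zl lx]] := F1 zx nzx zy yx.
have dl : d l = k.+1 by case: (edge_distance zl); case: (edge_distance lx); lia.
rewrite (leq_trans (geq_minr _ _)) //; apply/card_gt1P; exists l, y.
by rewrite !predsE ?dx ?dy ?dl.
Qed.

Lemma num_edges_levels : num_edges e = \sum_x (#|preds x| + #|laterals x|).
Proof.
(* Ordering by distance, then by index, directs each edge toward the end it is charged to. *)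
pose q x y := (d x < d y) || ((d x == d y) && (x < y)).
apply: double_inj; rewrite -handshake // -(double_tournament_edges simp (q := q)).
  rewrite exchange_big; congr _.*2; apply: eq_bigr => x _.
  rewrite -!sum1_card [X in _ = X + _]big_mkcond [X in _ = _ + X]big_mkcond -big_split.
  apply: eq_bigr => y _ /=.
  by rewrite !inE /q; case: (e y x) => //=; case: ltngtP => //=; case: ltngtP.
by move=> x y; rewrite /q -val_eqE /=; lia.
Qed.

(** The forced numbers sum to [2 * n - 2 - degree e v]: relative to two per vertex, the root lacks
    two and each of its neighbors lacks one. *)
Lemma sum_excess : 3 < n -> num_edges e = 2 * n - 4 ->
  \sum_x excess x + 2 = degree e v.
Proof.
move=> n3; rewrite num_edges_levels => sE.
have sX : \sum_x (#|preds x| + #|laterals x|) = \sum_x excess x + \sum_x minn (d x) 2.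
  rewrite -big_split; apply: eq_bigr => x _ /=; rewrite /excess subnK //.
  by have := minn_le_preds x; lia.
have sM : \sum_x minn (d x) 2 + \sum_x (d x == 1) + \sum_x (x == v).*2 = 2 * n.
  rewrite -!big_split mulnC -[X in X * 2](card_ord n) -sum_nat_const; apply: eq_bigr => x _ /=.
  by have [d0 _ _] := dist; rewrite -d0; case: (d x) => [|[|]] //=; lia.
have s1 : \sum_x (d x == 1) = degree e v.
  rewrite /degree -level1 -sum1_card [RHS]big_mkcond.
  by apply: eq_bigr => x _; rewrite inE; case: eqP.
have s0 : \sum_x (x == v).*2 = 2.
  by rewrite (bigD1 v) //= eqxx big1 // => x /negbTE ->.
by lia.
Qed.

Lemma level_top : exists w, forall x, d x <= d w.
Proof. by exists [arg max_(i > v) d i]; case: arg_maxnP => // i _ H x; apply: H. Qed.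

(** * Root of degree 2: the double-ended candle *)

Section Tight.
Hypothesis F2 : common_neighbor_extension e.
Hypothesis deg2 : degree e v = 2.
Hypothesis tight : forall x, excess x = 0.

Lemma tight_preds x : #|preds x| = minn (d x) 2.
Proof. by have := tight x; rewrite /excess; have := minn_le_preds x; lia. Qed.

Lemma tight_no_laterals x y : e x y -> d x <> d y.
Proof.
move=> exy dxy; wlog yx : x y exy dxy / y < x.
  move=> H; case: (ltngtP x y) => [xy|yx|/val_inj xy].
  - by apply: (H y x) => //; rewrite (proj1 simp).
  - exact: (H x y).
  - by rewrite xy (proj2 simp) in exy.
have : y \in laterals x by rewrite inE (proj1 simp) exy dxy eqxx yx.
have /eqP := tight x; rewrite /excess tight_preds addKn cards_eq0 => /eqP ->.
by rewrite inE.
Qed.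

Lemma tight_edge x y : e x y -> d y = (d x).+1 \/ d x = (d y).+1.
Proof. by move=> xy; have := tight_no_laterals xy; case: (edge_distance xy); lia. Qed.

(** The vertex [u] serves as pivot: with each vertex of level [i.+1] it shares exactly the neighbors
    [a] and [b], as [common_neighbor_extension] requires. *)
Definition saturated_level i := exists a b u,
  [/\ level i = [set a; b], a != b, e u a, e u b & (d u).+1 = i].

Lemma saturated_level1 : saturated_level 1.
Proof.
have /eqP := deg2; rewrite /degree => /cards2P [a [b [ab vE]]]; exists a, b, v.
have in_v z : z \in [set a; b] -> e v z by rewrite -vE inE.
by rewrite level1 vE dv; split=> //; apply: in_v; rewrite !inE eqxx ?orbT.
Qed.

Lemma saturated_preds i x : saturated_level i -> d x = i.+1 -> preds x = level i.
Proof.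
move=> [a [b [u [Li ab _ _ du]]]] dx; apply/eqP; rewrite eqEcard Li cards2 ab.
rewrite tight_preds dx -du; apply/andP; split; last by lia.
apply/subsetP=> y /in_preds []; rewrite -Li inE dx => _ [->]; exact: eqxx.
Qed.

(** Applied to the pivot [u], [common_neighbor_extension] gives [x] and [y] a common neighbor
    outside level [i]. No edge lies inside a level, so it is one level up, where it has only two
    predecessors. *)
Lemma saturated_common_succ i x y : saturated_level i ->
    d x = i.+1 -> d y = i.+1 -> x != y ->
  exists2 p, d p = i.+2 & preds p = [set x; y].
Proof.
move=> sat dx dy xy; have [a [b [u [Li ab ua ub du]]]] := sat.
have far z : d z = i.+1 -> u != z /\ ~~ e u z.
  by move=> dz; apply: distance_ge2_nonadjacent; rewrite dz -du.
have cn z : d z = i.+1 -> forall k, (e u k && e k z) = (k \in [:: a; b]).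
  move=> dz k; have -> : (k \in [:: a; b]) = (k \in preds z).
    by rewrite (saturated_preds sat dz) Li !inE.
  apply/andP/idP=> [[uk kz]|kz].
    by rewrite predsE //; move: (tight_edge uk) (tight_edge kz) du; rewrite dz; clear; lia.
  have [? _] := in_preds kz; split=> //.
  by move: kz; rewrite (saturated_preds sat dz) Li !inE => /orP[] /eqP ->.
have nxy : ~~ e x y by apply/negP=> /tight_no_laterals; rewrite dx dy.
have [ux nux] := far x dx; have [uy nuy] := far y dy.
have [p pab /andP[xp py]] := F2 ab ux uy xy nux nuy nxy (cn x dx) (cn y dy).
have dp : d p = i.+2.
  have [|dpx] := tight_edge xp; first by rewrite dx.
  have : p \in level i by move: dpx; rewrite inE dx => -[->].
  by rewrite Li; move: pab; rewrite !inE => /negPf ->.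
exists p => //; apply/esym/eqP; rewrite eqEcard tight_preds dp cards2 xy andbT.
apply/subsetP=> z; rewrite !inE => /orP[] /eqP ->; rewrite ?xp ?dx ?dy ?dp /= ?leqnn //.
by rewrite (proj1 simp) py.
Qed.

(** Three vertices [x], [y], [z] would have successors [p] over [x], [y] and [q] over [x], [z]; a
    common successor of [p] and [q] then has a single common neighbor with [z]. *)
Lemma saturated_next_le2 i : saturated_level i -> #|level i.+1| <= 2.
Proof.
move=> sat; rewrite leqNgt; apply/negP=> /card_gt2P [x [y [z []]]].
rewrite !inE => -[/eqP dx /eqP dy /eqP dz] [xy yz zx].
have [p dp pE] := saturated_common_succ sat dx dy xy.
have [|q dq qE] := saturated_common_succ sat dx dz; first by rewrite eq_sym.
have [yp zq] : y \in preds p /\ z \in preds q by rewrite pE qE !inE !eqxx !orbT.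
have [xp xq] : x \in preds p /\ x \in preds q by rewrite pE qE !inE !eqxx.
have zp : z \notin preds p by rewrite pE !inE negb_or zx eq_sym yz.
have npq : p != q by apply: contraNneq zp => ->.
have epq : ~~ e p q by apply/negP=> /tight_no_laterals; rewrite dp dq.
have [px _] := in_preds xp; have [exq _] := in_preds xq; have [ezq _] := in_preds zq.
have exp : e p x by rewrite (proj1 simp).
(* [p] and [q] have only [x] as common predecessor, so [r] lies above them. *)
have [r rx /andP[pr rq]] := F1 npq epq exp exq.
have dr : d r = i.+3.
  have [|dpr] := tight_edge pr; first by rewrite dp.
  have : r \in preds p by rewrite predsE // (proj1 simp).
  have : r \in preds q by rewrite predsE ?dq -?dp.
  rewrite pE qE !inE (negPf rx) /= => /eqP -> /eqP zy.
  by rewrite zy eqxx in yz.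
have rE : preds r = [set p; q].
  apply/esym/eqP; rewrite eqEcard tight_preds dr cards2 npq andbT.
  apply/subsetP=> t; rewrite !inE => /orP[] /eqP ->; rewrite ?pr ?dp ?dq ?dr /= ?leqnn //.
  by rewrite (proj1 simp) rq.
have [zr nzr] : z != r /\ ~~ e z r by apply: distance_ge2_nonadjacent; rewrite dz dr.
have qr : e q r by rewrite (proj1 simp).
(* A second common neighbor of [z] and [r] could only be [p], which is not adjacent to [z]. *)
have [l lq /andP[zl lr]] := F1 zr nzr ezq qr.
have dl : d l = i.+2 by move: (tight_edge zl) (tight_edge lr); rewrite dz dr; clear; lia.
have : l \in preds r by rewrite predsE ?dr ?dl.
rewrite rE !inE (negPf lq) orbF => /eqP lp.
by move: zp; rewrite predsE ?dp ?dz // -lp zl.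
Qed.

(** The two predecessors of [x] fill level [i.+1], and each is adjacent to all of level [i], so [a]
    is the new pivot. *)
Lemma saturated_next i x : saturated_level i -> d x = i.+2 -> saturated_level i.+1.
Proof.
move=> sat dx; have [a [b [u [Li ab ua ub du]]]] := sat.
have subx : preds x \subset level i.+1.
  by apply/subsetP=> y /in_preds []; rewrite dx inE => _ [->].
have /eqP px : level i.+1 == preds x.
  by rewrite eq_sym eqEcard subx tight_preds dx saturated_next_le2.
have /eqP/cards2P [s [t [st xE]]] : #|preds x| = 2 by rewrite tight_preds dx.
have next z : z \in preds x -> e a z.
  rewrite -px inE => /eqP dz; suff /in_preds[] : a \in preds z by [].
  by rewrite (saturated_preds sat dz) Li !inE eqxx.
exists s, t, a; split=> //; rewrite ?px //; try by apply: next; rewrite xE !inE eqxx ?orbT.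
have : a \in level i by rewrite Li !inE eqxx.
by rewrite inE => /eqP ->.
Qed.

(** Induction from level 1; the vertex that [saturated_next] needs is found by descending from
    [x]. *)
Lemma saturated_below i x : i < d x -> 0 < i -> saturated_level i.
Proof.
have [_ _ dP] := dist.
have descend m k y : d y = m + k -> exists z, d z = k.
  by elim: m y => [|m IH] y dy; [exists y | have [z _ /IH] := dP y (m + k) dy].
elim: i => // -[|i] IH ix _; first exact: saturated_level1.
have [|z dz] := descend (d x - i.+3) i.+3 x _; first by rewrite subnK.
by apply: saturated_next dz; apply: IH => //; apply: ltnW.
Qed.

Lemma card_below x i : i < d x -> #|[set y | d y < i.+1]| = i.*2.+1.
Proof.
elim: i => [|i IH] ix.
  transitivity #|level 0|; last by rewrite level0 cards1.
  by apply: eq_card => y; rewrite !inE; case: (d y).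
have [a [b [u [Li ab _ _ _]]]] := saturated_below ix isT.
have -> : [set y | d y < i.+2] = [set y | d y < i.+1] :|: level i.+1.
  by apply/setP=> y; rewrite !inE ltnS leq_eqVlt orbC.
rewrite cardsU disjoint_setI0 ?cards0 ?subn0; last first.
  by rewrite disjoints_subset; apply/subsetP=> y; rewrite !inE => yi; rewrite neq_ltn yi.
by rewrite IH 1?ltnW // Li cards2 ab addn2 doubleS.
Qed.

Lemma card_level_le2 x : #|level (d x)| <= 2.
Proof.
case dx: (d x) => [|[|i]]; first by rewrite level0 cards1.
  by rewrite level1 -/(degree e v) deg2.
by apply/saturated_next_le2/(saturated_below (x := x)); rewrite ?dx.
Qed.

Definition precedes y x := (d y < d x) || ((d y == d x) && (y < x)).

(** Below level [i.+1] lie the root and [i] pairs, so a vertex at distance [i.+1] has rank [i.*2.+1]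
    or [i.*2.+2], and [candle_level] sends both to [i.+1]. *)
Lemma card_precedes_level x : candle_level #|[set y | precedes y x]| = d x.
Proof.
have -> : [set y | precedes y x] = [set y | d y < d x] :|: [set y in level (d x) | y < x].
  by apply/setP=> y; rewrite !inE.
rewrite cardsU disjoint_setI0 ?cards0 ?subn0; last first.
  rewrite disjoints_subset; apply/subsetP=> y; rewrite !inE => yi.
  by rewrite negb_and neq_ltn yi.
have : #|[set y in level (d x) | y < x]| < #|level (d x)|.
  apply/proper_card/properP; split; first by apply/subsetP=> y; rewrite inE => /andP[].
  by exists x; rewrite !inE ?ltnn ?andbF.
have := card_level_le2 x; rewrite /candle_level.
case dx: (d x) => [|i]; last by rewrite (@card_below x) ?dx //;
  by move: #|[set y in _ | _]| #|level _| => c l; lia.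
rewrite level0 cards1; have -> : [set y | d y < 0] = set0 by apply/setP=> y; rewrite !inE.
by rewrite cards0; move: #|[set y in _ | _]| => c; lia.
Qed.

(** Consecutive levels are completely joined, since the predecessors of a vertex fill the level
    before it. *)
Lemma tight_adjacency x y : e x y = ((d x).+1 == d y) || ((d y).+1 == d x).
Proof.
have succ s t : (d s).+1 = d t -> e s t.
  move=> st; case ds: (d s) => [|i].
    have : s \in level 0 by rewrite inE ds.
    rewrite level0 inE => /eqP sv; have : t \in level 1 by rewrite inE -st ds.
    by rewrite level1 inE sv.
  have sat : saturated_level (d s) by apply: (saturated_below (x := t)); rewrite -?st ?ds.
  have : s \in preds t by rewrite (saturated_preds sat) ?inE.
  by case/in_preds.
apply/idP/orP=> [/tight_edge[] ->|[] /eqP /succ //]; [by left|by right|].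
by rewrite (proj1 simp).
Qed.

Lemma tight_candle : graph_iso e (@candle n).
Proof.
have rank_lt x : #|[set y | precedes y x]| < n.
  rewrite -[X in _ < X]card_ord -cardsT; apply/proper_card/properP.
  by split; [exact: subsetT | exists x; rewrite // inE /precedes !ltnn andbF].
have rank_mono x y : precedes x y -> #|[set z | precedes z x]| < #|[set z | precedes z y]|.
  move=> xy; apply/proper_card/properP; split; last first.
    by exists x; rewrite inE // /precedes !ltnn andbF.
  by apply/subsetP=> z; move: xy; rewrite !inE /precedes; lia.
exists (fun x => Ordinal (rank_lt x)); split; last first.
  by move=> x y; rewrite tight_adjacency -(card_precedes_level x) -(card_precedes_level y).
apply: injF_bij => x y /(congr1 val) /= rxy; apply/eqP/contraT => nxy.
have : precedes x y || precedes y x by move: nxy; rewrite /precedes -val_eqE /=; lia.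
by case/orP=> /rank_mono; rewrite rxy ltnn.
Qed.
End Tight.

(** * Root of degree 3 and minimum degree 3: the cube *)

Section Cubic.
Hypotheses (deg3 : degree e v = 3) (mindeg : forall x, 3 <= degree e x).
Hypotheses (sum1 : \sum_x excess x = 1) (n8 : 8 <= n).

Lemma excess0 x : excess x = 0 -> #|preds x| = minn (d x) 2 /\ laterals x = set0.
Proof.
rewrite /excess => x0; have := minn_le_preds x => le_x.
by split; [lia | apply/eqP; rewrite -cards_eq0; lia].
Qed.

Lemma level_eccentricity_ge2 t : (forall x, d x <= d t) -> 2 <= d t.
Proof.
move=> top; rewrite ltnNge; apply/negP=> t1.
have : #|'I_n| <= #|level 0 :|: level 1|.
  apply/subset_leq_card/subsetP=> x _; rewrite !inE.
  by have := leq_trans (top x) t1; case: (d x) => [|[|]].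
have := leq_card_setU (level 0) (level 1).
by rewrite level0 cards1 level1 -/(degree e v) deg3 card_ord => -[H _]; lia.
Qed.

Lemma top_lateral_or_preds x : (forall y, d y <= d x) ->
  (exists2 y, e x y & d y = d x) \/ 3 <= #|preds x|.
Proof.
move=> top; have [/existsP[y /andP[xy /eqP]]|/existsPn none] :=
  boolP [exists y, e x y && (d y == d x)]; first by left; exists y.
right; apply: leq_trans (mindeg x) _; apply/subset_leq_card/subsetP=> y.
rewrite !inE => xy; rewrite (proj1 simp) xy ltn_neqAle top andbT.
by have := none y; rewrite xy.
Qed.

(** The total excess 1 sits at one vertex [w], to which every edge inside a level is charged. Any
    other vertex of the last level has only two predecessors, so minimum degree 3 joins it to [w]
    inside that level. *)
Lemma cubic_top : exists w, [/\ forall x, d x <= d w,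
    forall x, d x < d w -> #|preds x| = minn (d x) 2,
    forall x y, e x y -> d x = d y -> d x = d w
  & (exists w', [/\ level (d w) = [set w; w'], #|preds w| = 2 & #|preds w'| = 2])
    \/ level (d w) = [set w] /\ #|preds w| = 3].
Proof.
have [w w_gt0] : exists w, 0 < excess w.
  apply/existsP; rewrite -[[exists _, _]]negbK negb_exists; apply/negP=> /forallP H.
  by move: sum1; rewrite big1 // => x _; have := H x; rewrite -leqNgt leqn0 => /eqP.
move: sum1; rewrite (bigD1 w) //= => sumw.
have xw1 : excess w = 1 by lia.
have x0 x : x != w -> excess x = 0.
  move=> xw; have /eqP : \sum_(i | i != w) excess i = 0
    by apply: (@addnI 1); rewrite -{1}xw1 sumw.
  by rewrite sum_nat_eq0 => /forallP/(_ x); rewrite xw => /eqP.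
have lat1 : #|laterals w| <= 1 /\ #|preds w| + #|laterals w| = minn (d w) 2 + 1.
  by move: xw1; rewrite /excess; have := minn_le_preds w; lia.
have lat_w x y : y \in laterals x -> x = w.
  move=> yx; apply/eqP; apply: contraLR yx => /x0 /excess0 [_ ->].
  by rewrite inE.
have edge_w x y : e x y -> d y = d x -> x != w -> y = w /\ x \in laterals w.
  move=> xy dyx xw; have [lt_xy|lt_yx|/val_inj xy'] := ltngtP x y.
  - have xl : x \in laterals y by rewrite inE xy dyx eqxx lt_xy.
    by have yw := lat_w _ _ xl; rewrite -yw.
  - have yl : y \in laterals x by rewrite inE (proj1 simp) xy dyx eqxx lt_yx.
    by rewrite (lat_w _ _ yl) eqxx in xw.
  - by rewrite xy' (proj2 simp) in xy.
have [t top] := level_top.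
have t2 := level_eccentricity_ge2 top.
have lateral_top x : d x = d t -> x != w -> e x w /\ d w = d x /\ x \in laterals w.
  move=> dx xw; have [|[y xy dy]|] := @top_lateral_or_preds x.
  - by rewrite dx.
  - by have [yw xl] := edge_w _ _ xy dy xw; rewrite yw in xy dy.
  - by have [-> _] := excess0 (x0 _ xw); rewrite leq_min andbF.
(* If [t] is not [w] itself, it is joined to [w] inside the last level. *)
have dw : d w = d t.
  by have [<- //|tw] := eqVneq t w; have [_ []] := lateral_top t erefl tw.
have {lat1}[lat1 predsw] : #|laterals w| <= 1 /\ #|preds w| + #|laterals w| = 3.
  by move: lat1; rewrite dw (minn_idPr t2).
exists w; split=> [x|x xlt|x y xy dxy|]; first by rewrite dw.
- have /x0/excess0[] // : x != w by apply: contraTneq xlt => ->; rewrite ltnn.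
- have [-> //|xw] := eqVneq x w.
  by have [yw _] := edge_w _ _ xy (esym dxy) xw; rewrite dxy yw.
have [/existsP[w' /andP[/eqP dw' w'w]]|/existsPn none] :=
  boolP [exists x, (d x == d w) && (x != w)].
  have [_ [_ w'l]] := lateral_top w' (etrans dw' dw) w'w.
  have /card_le1_eqP eql : #|laterals w| <= 1 by [].
  left; exists w'; split.
  - apply/setP=> x; rewrite !inE; apply/eqP/orP=> [dx|[] /eqP -> //].
    have [-> //|xw] := eqVneq x w; first by left.
    have [_ [_ xl]] := lateral_top x (etrans dx dw) xw.
    by right; rewrite (eql _ _ xl w'l).
  - have : 0 < #|laterals w| by apply/card_gt0P; exists w'.
    by move: predsw; case: #|laterals w| lat1 => [|[|]] // _; rewrite addn1 => -[].
  - by have [-> _] := excess0 (x0 _ w'w); rewrite dw' dw (minn_idPr t2).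
right; split.
  apply/setP=> x; rewrite !inE; apply/eqP/eqP=> [dx|-> //].
  by have := none x; rewrite dx eqxx /= negbK => /eqP.
have [x|[y wy dy]|] := @top_lateral_or_preds w; first by rewrite dw.
  have := none y; rewrite dy eqxx /= negbK => /eqP yw.
  by rewrite yw (proj2 simp) in wy.
by move=> w3; apply/eqP; rewrite eqn_leq w3 -{1}predsw leq_addr.
Qed.

(** Two pairs inside the three-element level 1 must meet. *)
Lemma common_pred (x y : 'I_n) :
    d x = 2 -> d y = 2 -> #|preds x| = 2 -> #|preds y| = 2 ->
  exists2 t, t \in preds x & t \in preds y.
Proof.
move=> dx dy px py.
have sub1 z : d z = 2 -> preds z \subset level 1.
  by move=> dz; apply/subsetP=> s /in_preds[]; rewrite dz inE => _ [->].
have /card_gt0P[t] : 0 < #|preds x :&: preds y|.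
  have := cardsUI (preds x) (preds y); have : #|preds x :|: preds y| <= 3.
    rewrite -deg3 /degree -level1; apply: subset_leq_card.
    by rewrite subUset !sub1.
  by lia.
by rewrite inE => /andP[]; exists t.
Qed.
Lemma level1_neighbors u y : (forall x y, e x y -> d x = 1 -> d y <> 1) ->
  d u = 1 -> e u y -> y = v \/ d y = 2.
Proof.
move=> nolat du uy; have := nolat _ _ uy du; have [d0 _ _] := dist.
case: (edge_distance uy) (d0 y); rewrite du; case: (d y) => [|[|[|]]] // _ _.
  by move/esym/eqP; left.
by right.
Qed.

Lemma level1_successor u z : (forall x y, e x y -> d x = 1 -> d y <> 1) ->
  d u = 1 -> exists y, [/\ e u y, d y = 2 & y != z].
Proof.
move=> nolat du; have [/existsP[y /and3P[uy /eqP dy yz]]|/existsPn none] :=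
  boolP [exists y, [&& e u y, d y == 2 & y != z]]; first by exists y.
have : #|[set y | e u y]| <= #|[set v; z]|.
  apply/subset_leq_card/subsetP=> y; rewrite !inE => uy.
  have [->|dy] := level1_neighbors nolat du uy; first by rewrite eqxx.
  by have := none y; rewrite uy dy eqxx /= negbK => ->; rewrite orbT.
by have := mindeg u; rewrite /degree cards2; case: (v != z); lia.
Qed.

(* Two vertices at distance 2 from v with different predecessors share one of
   the three neighbors of v, hence have a second common neighbor; if it had no
   further predecessor, it would share exactly one neighbor with a vertex of
   level 1. *)
Lemma cubic_level3 : exists w, [/\ forall x, d x <= 3, level 3 = [set w],
    #|preds w| = 3, forall x, d x < 3 -> #|preds x| = minn (d x) 2
  & forall x y, e x y -> d x <> d y].
Proof.
have [w [top exact2 lat_top shape]] := cubic_top.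
have w2 := level_eccentricity_ge2 top.
have nolat1 x y : e x y -> d x = 1 -> d y <> 1.
  by move=> xy dx dy; have := lat_top _ _ xy; rewrite dx dy => /(_ erefl) dw; rewrite -dw in w2.
have in1 : {in level 1, forall u, d u = 1} by move=> u; rewrite inE => /eqP.
have card1 : #|level 1| = 3 by rewrite level1.
have [u0 /in1 du0] : exists u, u \in level 1 by apply/card_gt0P; rewrite card1.
(* If level 2 is the last, it is not [w] alone: [level1_successor] yields another vertex in it. *)
have exact_level2 x : d x = 2 -> #|preds x| = 2.
  move=> dx; have [lt2w|] := ltnP 2 (d w); first by rewrite exact2 dx.
  move=> w2'; have dw : d w = 2 by apply/eqP; rewrite eqn_leq w2 w2'.
  have : x \in level (d w) by rewrite inE dx dw.
  case: shape => [[w' [-> pw pw']]|[Lw _]].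
    by rewrite !inE => /orP[] /eqP ->.
  have [y [_ dy yw]] := level1_successor w nolat1 du0.
  have : y \in level (d w) by rewrite inE dy dw.
  by rewrite Lw inE (negPf yw).
have top2 x y z : d w = 2 -> d x = 2 -> d y = 2 -> d z = 2 -> x != y -> y != z -> z != x -> False.
  move=> dw dx dy dz xy yz zx.
  have : 2 < #|level (d w)| by apply/card_gt2P; exists x, y, z; rewrite !inE dx dy dz dw.
  case: shape => [[w' [-> _ _]]|[-> _]]; last by rewrite cards1.
  by rewrite cards2; case: (w != w').
have [x [_ dx _]] := level1_successor v nolat1 du0.
(* [x] misses one of the three vertices of level 1; a successor [y] of that vertex has different
   predecessors. *)
have [u u1 ux] : exists2 u, u \in level 1 & u \notin preds x.
  apply/subsetPn/negP=> /subset_leq_card.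
  by rewrite card1 exact_level2.
have du := in1 _ u1.
have [y [uy dy yx]] := level1_successor x nolat1 du.
have uyP : u \in preds y by rewrite predsE ?dy ?du.
have nux : ~~ e u x by move: ux; rewrite predsE ?dx ?du.
have u_x : u != x by apply: contra_eqN dx => /eqP <-; rewrite du.
have [t tx ty] := common_pred dx dy (exact_level2 _ dx) (exact_level2 _ dy).
have [etx dt] := in_preds tx; have [ety _] := in_preds ty.
(* An edge between [x] and [y] makes level 2 the last, of size at most two; yet the second common
   neighbor of [u] and [x] would be a third vertex in it. *)
have [exy|nxy] := boolP (e x y).
  have dw : d w = 2 by rewrite -(lat_top _ _ exy) dx ?dy.
  have eyx : e y x by rewrite (proj1 simp).
  have [l ly /andP[ul lx]] := F1 u_x nux uy eyx.
  have [lv|dl] := level1_neighbors nolat1 du ul.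
    by have := edge_distance lx; rewrite lv dv dx => -[].
  exfalso; apply: (@top2 x y l) => //; first by rewrite eq_sym.
    by rewrite eq_sym.
  by apply: contraTneq lx => ->; rewrite (proj2 simp).
have ext : e x t by rewrite (proj1 simp).
have xy : x != y by rewrite eq_sym.
have [r rt /andP[xr ry]] := F1 xy nxy ext ety.
have yr : e y r by rewrite (proj1 simp).
have rx : e r x by rewrite (proj1 simp).
have dt1 : d t = 1 by move: dt; rewrite dx => -[].
have : d r = 1 \/ d r = 2 \/ d r = 3.
  by case: (edge_distance xr); rewrite dx; case: (d r) => [|[|[|[|]]]]; auto.
case=> [dr|[dr|dr]].
(* [r] in level 1: both predecessor sets would be [[set r; t]], but [u] lies in only one of them. *)
- have sub z : z = x \/ z = y -> preds z = [set r; t].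
    move=> zxy; apply/esym/eqP; rewrite eqEcard cards2 rt.
    case: zxy => ->; rewrite exact_level2 // andbT; apply/subsetP=> s;
      by rewrite !inE => /orP[] /eqP ->; rewrite ?rx ?ry ?etx ?ety ?dr ?dt1 ?dx ?dy.
  by move: ux; rewrite (sub x) ?(sub y) -?(sub y) ?uyP //; auto.
(* [r] in level 2: its edge to [x] makes that level the last, now with three vertices. *)
- have dw : d w = 2 by rewrite -(lat_top _ _ rx) dr ?dx.
  exfalso; apply: (@top2 x y r) => //.
    by apply: contraTneq ry => ->; rewrite (proj2 simp).
  by apply: contraTneq rx => ->; rewrite (proj2 simp).
have not2 : #|preds r| <> 2.
  move=> pr2; have rE : preds r = [set x; y].
    apply/esym/eqP; rewrite eqEcard pr2 cards2 xy andbT; apply/subsetP=> s.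
    by rewrite !inE => /orP[] /eqP ->; rewrite ?xr ?yr ?dr ?dx ?dy.
  have [ur nur] : u != r /\ ~~ e u r by apply: distance_ge2_nonadjacent; rewrite du dr.
  have [l ly /andP[ul lr]] := F1 ur nur uy yr.
  have [lv|dl] := level1_neighbors nolat1 du ul.
    by have := edge_distance lr; rewrite lv dv dr => -[].
  have : l \in preds r by rewrite predsE ?dr ?dl.
  rewrite rE !inE (negPf ly) orbF => /eqP lx.
  by rewrite lx (negPf nux) in ul.
(* A vertex of level 3 without exactly two predecessors must be [w], in the one-vertex shape of the
   last level. *)
have dw : d w = 3.
  apply/eqP; rewrite eqn_leq -{2}dr top andbT leqNgt; apply/negP=> w3.
  by apply: not2; rewrite exact2 dr.
have rw : r \in level (d w) by rewrite inE dw dr.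
have [Lw pw] : level (d w) = [set w] /\ #|preds w| = 3.
  case: shape => // -[w' [Lw pw pw']]; exfalso; apply: not2.
  by move: rw; rewrite Lw !inE => /orP[] /eqP ->.
have dle3 s : d s <= 3 by rewrite -dw.
exists w; split=> // [|s|s s' ss' ds]; first by rewrite -dw.
  by rewrite -dw; apply: exact2.
have ds3 := lat_top _ _ ss' ds.
have [] : s \in [set w] /\ s' \in [set w] by rewrite -Lw !inE -ds ds3.
by rewrite !inE => /eqP sw /eqP s'w; rewrite sw s'w (proj2 simp) in ss'.
Qed.

(** Levels have sizes 1, 3, 3, 1. Each vertex of level 2 is joined to [w] and misses exactly one
    neighbor of [v], distinct vertices missing distinct ones: the cube seen from a corner. *)
Lemma cubic_Q3 : graph_iso e Q3.
Proof.
have [w [top L3 pw3 exact nolat]] := cubic_level3.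
have edge s s' : e s s' -> d s' = (d s).+1 \/ d s = (d s').+1.
  by move=> ss'; have := nolat _ _ ss'; case: (edge_distance ss'); lia.
have dw : d w = 3 by have : w \in level 3; [rewrite L3 inE | rewrite inE => /eqP].
have preds_level i s : d s = i.+1 -> preds s \subset level i.
  by move=> ds; apply/subsetP=> y /in_preds[]; rewrite ds inE => _ [->].
have card1 : #|level 1| = 3 by rewrite level1.
have card2 s : d s = 2 -> #|preds s| = 2 by move=> ds; rewrite exact ds.
(* Otherwise the neighbors of [s] would be just its two predecessors. *)
have ew s : d s = 2 -> e s w.
  move=> ds; apply/negPn/negP=> nsw.
  suff : #|[set y | e s y]| <= 2 by have := mindeg s; rewrite /degree; lia.
  rewrite -(card2 s ds); apply/subset_leq_card/subsetP=> y; rewrite inE => sy.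
  have [dy|dy] := edge _ _ sy; last by rewrite predsE // (proj1 simp).
  have : y \in level 3 by rewrite inE dy ds.
  by rewrite L3 inE => /eqP yw; rewrite -yw sy in nsw.
have L2 : preds w = level 2.
  apply/eqP; rewrite eqEsubset preds_level //=; apply/subsetP=> s.
  by rewrite inE => /eqP ds; rewrite predsE ?dw ?ds // ew.
have miss s : d s = 2 -> exists2 m, d m = 1 & forall u, d u = 1 -> e u s = (u != m).
  move=> ds; have /eqP/cards1P[m mE] : #|level 1 :\: preds s| = 1.
    by rewrite cardsD (setIidPr (preds_level _ _ ds)) card1 card2.
  exists m => [|u du].
    have : m \in level 1 :\: preds s by rewrite mE inE.
    by rewrite in_setD [m \in level 1]inE => /andP[_ /eqP].
  have : (u \in level 1 :\: preds s) = (u == m) by rewrite mE inE.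
  by rewrite in_setD predsE ?ds ?du // inE du eqxx andbT => <-; rewrite negbK.
(* A vertex [u] missed by both could only be adjacent to [v] and to the third vertex of level 2. *)
have miss_inj s s' u : d s = 2 -> d s' = 2 -> s != s' -> d u = 1 -> e u s || e u s'.
  move=> ds ds' ss' du; apply/negPn/negP; rewrite negb_or => /andP[nus nus'].
  have sub : [set y | e u y] \subset v |: (level 2 :\: [set s; s']).
    apply/subsetP=> y; rewrite !inE => uy.
    have nolat1 t t' : e t t' -> d t = 1 -> d t' <> 1.
      by move=> tt' dt dt'; apply: (nolat _ _ tt'); rewrite dt.
    have [->|dy] := level1_neighbors nolat1 du uy; first by rewrite eqxx.
    rewrite dy eqxx andbT negb_or; apply/orP; right.
    by apply/andP; split; apply: contraTneq uy => ->.
  have := subset_leq_card sub; rewrite cardsU1 cardsD -L2 pw3.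
  have -> : preds w :&: [set s; s'] = [set s; s'].
    by apply/setIidPr/subsetP=> y; rewrite L2 !inE => /orP[] /eqP ->; rewrite ?ds ?ds'.
  by rewrite cards2 ss'; have := mindeg u; rewrite /degree; case: (v \notin _); lia.
have /card_gt2P[x [y [z [[]]]]] : 2 < #|level 2| by rewrite -L2 pw3.
rewrite !inE => /eqP dx /eqP dy /eqP dz [xy yz zx].
have [a da ax] := miss x dx; have [b db by_] := miss y dy; have [c dc cz] := miss z dz.
have ab : a != b.
  apply/negP=> /eqP ab; have := miss_inj x y a dx dy xy da.
  by rewrite ax // by_ // ab eqxx.
have bc : b != c.
  apply/negP=> /eqP bc; have := miss_inj y z b dy dz yz db.
  by rewrite by_ // cz // bc eqxx.
have ca : c != a.
  apply/negP=> /eqP ca; have := miss_inj z x c dz dx zx dc.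
  by rewrite cz // ax // ca eqxx.
have cover3 (B : {set 'I_n}) p q r : #|B| = 3 -> p \in B -> q \in B -> r \in B ->
    p != q -> q != r -> r != p -> forall s, s \in B -> [|| s == p, s == q | s == r].
  move=> B3 pB qB rB pq qr rp s.
  suff <- : [set p; q; r] = B by rewrite !inE orbA.
  apply/eqP; rewrite eqEcard B3; apply/andP; split.
    by apply/subsetP=> t; rewrite !inE -orbA => /or3P[] /eqP ->.
  by rewrite setUC cardsU1 cards2 pq !inE negb_or rp eq_sym qr.
(* Positions in binary are cube coordinates: [a], [b], [c] at 001, 010, 100, and [x], [y], [z] at
   the complements of the neighbors of [v] they miss. *)
pose S := [:: v; a; b; z; c; y; x; w].
have mem_S s : s \in S.
  have : d s <= 3 by []; rewrite !inE; case ds: (d s) => [|[|[|[|k]]]] // _.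
  - have : s \in level 0 by rewrite inE ds.
    by rewrite level0 inE => ->.
  - have := cover3 (level 1) a b c card1; rewrite !inE da db dc => H.
    by have := H isT isT isT ab bc ca s; rewrite inE ds => /(_ isT) /or3P[] ->; rewrite ?orbT.
  - have := cover3 (level 2) x y z; rewrite -{1}L2 pw3 !inE dx dy dz => H.
    by have := H erefl isT isT isT xy yz zx s; rewrite inE ds => /(_ isT) /or3P[] ->; rewrite ?orbT.
  - have : s \in level 3 by rewrite inE ds.
    by rewrite L3 inE => ->; rewrite !orbT.
(* A list of 8 entries covering at least 8 vertices has no repetition. *)
have uniqS : uniq S.
  apply: (leq_size_uniq (enum_uniq 'I_n)) => [s _|]; first exact: mem_S.
  by rewrite -cardE card_ord.
pose g (i : 'I_8) := nth v S i.
have g_inj : injective g.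
  by move=> i j /eqP; rewrite nth_uniq // => /eqP /val_inj.
have [f fK gK] : bijective g.
  apply: inj_card_bij => //; rewrite !card_ord -[X in X <= _]card_ord.
  apply: leq_trans (card_size S); apply/subset_leq_card/subsetP=> s _; exact: mem_S.
have apart s s' : (d s' != (d s).+1) && (d s != (d s').+1) -> e s s' = false.
  by move=> H; apply/negP=> /edge[] ds; move: H; rewrite ds eqxx ?andbF.
have vL s : d s = 1 -> e v s.
  move=> ds; have : s \in level 1 by rewrite inE ds.
  by rewrite level1 inE.
have gQ i j : Q3 i j = e (g i) (g j).
  have edges : [/\ e v a, e v b, e v c & [/\ e x w, e y w & e z w]].
    by split; [exact: vL..|split; exact: ew].
  have ba : b != a by rewrite eq_sym.
  have cb : c != b by rewrite eq_sym.
  have ac : a != c by rewrite eq_sym.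
  have middle : [/\ [/\ e a x = false, e b x & e c x],
     [/\ e a y, e b y = false & e c y] & [/\ e a z, e b z & e c z = false]].
    by split; split; rewrite ?ax ?by_ ?cz ?eqxx.
  case: edges => va vb vc [xw yw zw]; case: middle => -[ax' bx cx] [ay by' cy] [az bz cz'].
  (* The 64 pairs: nonconsecutive levels, a recorded incidence, or one with its ends swapped. *)
  case: i => -[|[|[|[|[|[|[|[|//]]]]]]]] ?; case: j => -[|[|[|[|[|[|[|[|//]]]]]]]] ?;
    rewrite /g /=; first
    [ by rewrite apart // ?dv ?da ?db ?dc ?dx ?dy ?dz ?dw
    | by rewrite ?va ?vb ?vc ?xw ?yw ?zw ?ax' ?bx ?cx ?ay ?by' ?cy ?az ?bz ?cz'
    | by rewrite (proj1 simp) ?va ?vb ?vc ?xw ?yw ?zw ?ax' ?bx ?cx ?ay ?by' ?cy ?az ?bz ?cz'].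
exists f; split; first by exists g.
by move=> s s'; rewrite gQ !gK.
Qed.
End Cubic.
End Levels.

(** * Choice of the root by minimum degree *)

Theorem mainTheorem8 (R : realType) (n : nat) (e : rel 'I_n) :
  simple_graph e -> ~~ odd n -> (4 <= n)%N -> connected_graph e ->
  q_eq R e 2 -> num_edges e = (2 * n - 4)%N ->
  graph_iso e Q3 \/ graph_iso e (@candle n).
Proof.
move=> simp _ n4 conn [[A [SA qA]] _] edges.
have F1 : unique_common_neighbor_free e.
  by move=> i j k; apply: not_unique_common_neighbor SA qA _ _ _.
have F2 : common_neighbor_extension e.
  by move=> i j l a b; apply: parallel_common_neighbor SA qA _ _ _ _ _.
have ge2 := degree_ge2 simp F1 conn (ltnW n4).
have [/existsP[v /eqP deg2]|/existsPn not2] := boolP [exists v, degree e v == 2].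
  have [d dist] := connected_distance v conn.
  (* A root of degree 2 makes the total excess 0, hence every excess 0. *)
  have := sum_excess simp F1 dist n4 edges; rewrite deg2 => /(@addIn 2 _ 0)/eqP.
  rewrite sum_nat_eq0 => /forallP tight; right.
  by apply: (tight_candle simp F1 dist F2 deg2) => x; apply/eqP/tight.
have ge3 x : 3 <= degree e x by rewrite ltn_neqAle ge2 eq_sym not2.
(* The average degree is below 4, so degree 3 occurs; minimum degree 3 gives [3 * n <= 4 * n - 8],
   hence [8 <= n]. *)
have sum_deg : \sum_x degree e x = 4 * n - 8 by rewrite (handshake simp) edges; lia.
have [v deg3] : exists v, degree e v = 3.
  apply/'exists_eqP; apply: contraT => /existsPn not3.
  have : \sum_(x < n) 4 <= \sum_x degree e x.
    by apply: leq_sum => x _; rewrite ltn_neqAle ge3 eq_sym not3.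
  by rewrite sum_deg sum_nat_const card_ord; lia.
have n8 : 8 <= n.
  have : \sum_(x < n) 3 <= \sum_x degree e x by apply: leq_sum.
  by rewrite sum_deg sum_nat_const card_ord; lia.
have [d dist] := connected_distance v conn.
have := sum_excess simp F1 dist n4 edges; rewrite deg3 => /(@addIn 2 _ 1) sum1.
by left; apply: (cubic_Q3 simp F1 dist deg3 ge3 sum1 n8).
Qed.
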